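(* Let $r\in\mathbb{N}$ be fixed and let $\chi:\mathbb{R}_+\to\mathbb{R}$ be a kernel such that $M_0(\chi)>0$. If $f\in CB_{\mathrm{comp}}(\mathbb{R}_+)$, then for every $1\le p<\infty$, $$\lim_{w\to\infty}\left\|E_{w,r}^{\chi}f-f\right\|_p=0.$$
   Context: $\mathbb{R}_+=(0,\infty)$. A kernel is a continuous function $\chi:\mathbb{R}_+\to\mathbb{R}$ such that: (1) $\int_{\mathbb{R}_+}|\chi(x)|\frac{dx}{x}<\infty$ and $\chi$ is bounded on $[1/e,e]$; (2) $\sum_{k\in\mathbb{Z}}\chi(e^{-k}u)=1$ for every $u\in\mathbb{R}_+$, and $M_0(\chi):=\sup_{u\in\mathbb{R}_+}\sum_{k\in\mathbb{Z}}|\chi(e^{-k}u)|<+\infty$; (3) $\lim_{\gamma\to\infty}\sum_{|k-\log u|>\gamma}|\chi(e^{-k}u)|=0$ uniformly with respect to $u\in\mathbb{R}_+$. For $r\in\mathbb{N}$, $w>0$ and a locally integrable $f:\mathbb{R}_+\to\mathbb{R}$, $$\left(E_{w,r}^{\chi}f\right)(x):=\sum_{k\in\mathbb{Z}}\chi(e^{-k}x^{w})\, w^{r}\int_1^{e^{1/w}}\!\!\cdots\!\int_1^{e^{1/w}}\sum_{m=1}^{r}(-1)^{1-m}\binom{r}{m}f\!\left(e^{k/w}(t_1\cdots t_r)^{m/r}\right)\frac{dt_1}{t_1}\cdots\frac{dt_r}{t_r},\quad x\in\mathbb{R}_+.$$ $CB_{\mathrm{comp}}(\mathbb{R}_+)$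 is the space of bounded continuous functions on $\mathbb{R}_+$ with compact support contained in $\mathbb{R}_+$. For measurable $g$, $\|g\|_p:=\left(\int_{\mathbb{R}_+}|g(x)|^p\frac{dx}{x}\right)^{1/p}$. *)

(* Defs.v *)
From HB Require Import structures.
From mathcomp Require Import all_boot all_order all_algebra.
From mathcomp Require Import all_classical all_reals all_analysis.
Set Implicit Arguments. Unset Strict Implicit. Unset Printing Implicit Defensive.
Import Order.TTheory GRing.Theory Num.Theory.
Import numFieldNormedType.Exports.
Local Open Scope classical_set_scope.
Local Open Scope ring_scope.

Section Defs.
Variable R : realType.

Local Notation mu := (@lebesgue_measure R).

Definition Rpos : set R := [set x : R | 0 < x].

Definition zpsum (F : int -> R) (N : nat) : R :=
  \sum_(0 <= i < (2 * N).+1) F (i%:Z - N%:Z).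

Definition zsum (F : int -> R) : R := limn (zpsum F).

Definition M0 (chi : R -> R) : \bar R :=
  ereal_sup [set (\esum_(k in [set: int]) (`|chi (expR (- k%:~R) * u)|)%R%:E)%E
            | u in Rpos].

Definition is_kernel (chi : R -> R) : Prop :=
  (forall x : R, 0 < x -> {for x, continuous chi}) /\
  (\int[mu]_(x in Rpos) (`|chi x| / x)%R%:E < +oo)%E /\
  (exists M : R, forall x : R, expR (-1) <= x <= expR 1 -> `|chi x| <= M) /\
  (forall u : R, 0 < u ->
     zpsum (fun k => chi (expR (- k%:~R) * u)) @ \oo --> (1 : R)) /\
  (M0 chi < +oo)%E /\
  (forall eps : R, 0 < eps -> exists g0 : R, forall g : R, g0 < g ->
     forall u : R, 0 < u ->
       (\esum_(k in [set k : int | (g < `|k%:~R - ln u|)%R])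
          (`|chi (expR (- k%:~R) * u)|)%R%:E <= eps%:E)%E).

Definition CB_comp (f : R -> R) : Prop :=
  (forall x : R, 0 < x -> {for x, continuous f}) /\
  (exists B : R, forall x : R, 0 < x -> `|f x| <= B) /\
  (exists a b : R, 0 < a /\ a <= b /\
     forall x : R, 0 < x -> (x < a \/ b < x) -> f x = 0).

(* r-fold iterated integral over [1, e^{1/w}]^r w.r.t. dt_1/t_1 ... dt_r/t_r
   of a function of the product t_1 ... t_r:
   iint w 0 g = g 1,
   iint w (n+1) g = \int_1^{e^{1/w}} iint w n (fun s => g (t * s)) dt/t *)
Fixpoint iint (w : R) (n : nat) (g : R -> R) : R :=
  match n with
  | 0%N => g 1
  | n'.+1 => \int[mu]_(t in `[1, expR w^-1]%classic)
               (iint w n' (fun s => g (t * s)) / t)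
  end.

Definition E_op (chi : R -> R) (w : R) (r : nat) (f : R -> R) (x : R) : R :=
  zsum (fun k : int =>
    chi (expR (- k%:~R) * x `^ w) * w ^+ r *
    iint w r (fun P : R =>
      \sum_(1 <= m < r.+1)
        ((-1) ^+ (1 + m) * 'C(r, m)%:R *
          f (expR (k%:~R / w) * P `^ (m%:R / r%:R))))).

Definition Lpnorm (p : R) (g : R -> R) : \bar R :=
  poweR (\int[mu]_(x in Rpos) (`|g x| `^ p / x)%R%:E)%E p^-1.

End Defs.

(* Main.v *)
(** Write E f - f at x as sum_k chi(e^{-k} x^w) (c_k - f x), where c_k is a
    combination, with coefficients of sum 1, of averages of f near e^{k/w}.
    Uniform continuity of f in the variable ln x controls the terms with
    |k - w ln x| bounded, and hypothesis (3) on the kernel controls the others,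
    so E f -> f uniformly.  Once |E f - f| <= 1, its p-th power is at most
    |E f - f| itself, so it suffices to treat p = 1.  On a compact
    |ln x| <= S the uniform bound is enough.  Outside, f vanishes and only O(w)
    indices k contribute; for each of them the substitution y = e^{-k} x^w,
    which sends dx/x to dy/(w y) and that region into |ln y| >= w, bounds the
    contribution by 1/w times a tail of the integral of |chi| dy/y.  The tail is
    cut off with min(1, |ln y|/n) so as to integrate only continuous functions. *)

Require Import Defs.
From HB Require Import structures.
From mathcomp Require Import all_boot all_order all_algebra.
From mathcomp Require Import all_classical all_reals all_analysis.
From mathcomp Require Import measurable_realfun ring lra.
Import Order.TTheory GRing.Theory Num.Theory.
Import numFieldNormedType.Exports.
Local Open Scope classical_set_scope.
Local Open Scope ring_scope.

(** * Uniform continuity in the variable $\ln x$ *)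

Definition log_unif_cont (R : realType) (g : R -> R) :=
  forall eps : R, 0 < eps -> exists2 d : R, 0 < d &
    forall x y : R, 0 < x -> 0 < y -> `|ln x - ln y| < d -> `|g x - g y| <= eps.

Lemma log_unif_cont_continuous (R : realType) (g : R -> R) (t : R) :
  log_unif_cont R g -> 0 < t -> {for t, continuous g}.
Proof.
move=> ug t0; apply/cvgrPdist_le => e e0.
have [d d0 hd] := ug e e0.
have t_gt0 : \forall s \near t, 0 < s by exact: lt_nbhsr.
have ln_near : \forall s \near t, `|ln t - ln s| < d.
  by have /cvgrPdist_lt /(_ _ d0) := continuous_ln t0.
by near=> s; apply: hd => //; near: s.
Unshelve. all: by end_near. Qed.

Lemma log_unif_cont_scale (R : realType) (g : R -> R) (t : R) :
  0 < t -> log_unif_cont R g -> log_unif_cont R (fun s => g (t * s)).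
Proof.
move=> t0 ug e e0; have [d d0 hd] := ug e e0; exists d => // x y x0 y0 xy.
apply: hd; rewrite ?mulr_gt0// !lnM ?posrE//.
by rewrite opprD addrACA subrr add0r.
Qed.

Lemma log_unif_cont_cst (R : realType) (v : R) : log_unif_cont R (fun=> v).
Proof.
by move=> e e0; exists 1 => // x y _ _ _; rewrite subrr normr0 ltW.
Qed.

Lemma CB_comp_log_support (R : realType) (f : R -> R) : CB_comp f ->
  exists2 A : R, 0 < A & forall x : R, 0 < x -> A < `|ln x| -> f x = 0.
Proof.
move=> [_ [_ [a [b [a0 [ab f0]]]]]].
have b0 : 0 < b by exact: lt_le_trans ab.
exists (`|ln a| + `|ln b| + 1) => [|x x0 xA].
  by rewrite ltr_pwDr// addr_ge0.
apply: f0 => //.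
have [lx|lx] := leP 0 (ln x).
- right; rewrite -ltr_ln ?posrE//.
  rewrite (ger0_norm lx) in xA.
  have h1 := ler_norm (ln b); have h2 := normr_ge0 (ln a). lra.
- left; rewrite -ltr_ln ?posrE//.
  rewrite (ltr0_norm lx) in xA.
  have h1 := ler_norm (- ln a); rewrite normrN in h1.
  have h2 := normr_ge0 (ln b); lra.
Qed.

(** Heine's theorem for [f \o expR] on the compact segment $[-(A+1),A+1]$; farther out, both points
    lie where [f] vanishes. *)
Lemma CB_comp_log_unif_cont (R : realType) (f : R -> R) :
  CB_comp f -> log_unif_cont R f.
Proof.
move=> fCB; have [A A0 fA] := CB_comp_log_support R f fCB.
have cf := fCB.1; move=> e e0.
pose H s := f (expR s).
have cH : continuous H.
  move=> s; apply: continuous_comp; first exact: continuous_expR.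
  by apply: cf; rewrite expR_gt0.
pose P (d s : R) := forall t, `|s - t| < d -> `|H s - H t| <= e.
(* Compactness makes one modulus [d] serve the whole segment. Locally, halving works: [s'] within
   [d / 2] of [s] and [t] within [d / 2] of [s'] both stay within [d] of [s]. *)
have : \forall d \near 0^'+, `[- (A + 1), A + 1] `<=` P d.
  have /compact_near_coveringP := @segment_compact R (- (A + 1)) (A + 1).
  apply => s _.
  have e20 : 0 < e / 2 by rewrite divr_gt0.
  have /cvgrPdist_le /(_ _ e20) [d /= d0 hd] := cH s.
  have d20 : 0 < d / 2 by rewrite divr_gt0.
  exists (ball s (d / 2), [set x | x < d / 2]).
    by split => /=; [exact: nbhsx_ballx|exact: nbhs_right_lt].
  move=> [s' d'] /= [ss' dd'] t s't.
  have hs' : `|H s - H s'| <= e / 2.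
    by apply: hd => /=; rewrite (lt_le_trans ss')// ler_pdivrMr// ler_peMr ?(ltW d0)// ler1n.
  have ht : `|H s - H t| <= e / 2.
    apply: hd => /=; rewrite -(subrKA s').
    by rewrite (le_lt_trans (ler_normD _ _))// [ltRHS](splitr d) ltrD// (lt_trans s't).
  rewrite -(subrKA (H s)) (le_trans (ler_normD _ _))//.
  by rewrite (splitr e) lerD// distrC.
move=> [d /= d0 hd].
(* The cap at 1 ensures that $|\ln x|>A+1$ forces $|\ln y|>A$; halving makes [d'] strictly smaller
   than [d], so that [hd] applies to it. *)
pose d' := Num.min (d / 2) 1.
have d'0 : 0 < d' by rewrite lt_min divr_gt0//=.
have d'd : d' < d.
  by rewrite gt_min ltr_pdivrMr// ltr_pMr// ltr1n.
exists d' => // x y x0 y0 xy.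
have /hd : ball 0 d d' by rewrite /ball/= sub0r normrN gtr0_norm.
move=> /(_ d'0) hP.
have [xA|xA] := leP `|ln x| (A + 1).
  have /hP : `[- (A + 1), A + 1]%classic (ln x) by rewrite /= in_itv/= -ler_norml.
  by move=> /(_ _ xy); rewrite /H !lnK.
have d'1 : d' <= 1 by rewrite ge_min lexx orbT.
rewrite (fA x)//; last by lra.
rewrite (fA y)//; first by rewrite subrr normr0 ltW.
have h1 := lerB_dist (ln x) (ln y); lra.
Qed.

(** * Iterated integrals over $[1,e^{1/w}]$ for $dt/t$ *)

Section iint.
Variables (R : realType) (w : R).
Hypothesis w0 : 0 < w.
Local Notation mu := (@lebesgue_measure R).
Local Notation I := `[1, expR w^-1]%classic.

Let expw_gt1 : 1 < expR w^-1.
Proof. by rewrite expR_gt1 invr_gt0. Qed.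

Lemma integrable_div_id (G : R -> R) : (forall t : R, 0 < t -> {for t, continuous G}) ->
  mu.-integrable I (EFin \o (fun t => G t / t)).
Proof.
move=> cG; apply: continuous_compact_integrable; first exact: segment_compact.
apply: continuous_in_subspaceT => t /[!inE]/=; rewrite in_itv/= => /andP[t1 _].
have t0 : 0 < t by rewrite (lt_le_trans _ t1).
apply: (@continuousM _ _ G (fun x => x^-1)); first exact: cG.
by apply: continuousV => //; rewrite gt_eqF.
Qed.

Lemma integrable_inv : mu.-integrable I (EFin \o (fun t => t^-1)).
Proof.
have c1 (t : R) : 0 < t -> {for t, continuous (fun=> 1 : R)}.
  by move=> _; exact: cst_continuous.
have := integrable_div_id (fun=> 1) c1.
by congr (_.-integrable _ _); apply/funext => t /=; rewrite mul1r.
Qed.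

(** Fundamental theorem of calculus with primitive [ln]. This total mass is what the factor $w^r$ of
    the operator normalizes, once per variable. *)
Lemma Rintegral_inv : \int[mu]_(t in I) t^-1 = w^-1.
Proof.
have cV : {in `[1, expR w^-1], continuous (fun t : R => t^-1)}.
  move=> t; rewrite in_itv/= => /andP[t1 _].
  by apply: continuousV => //; rewrite gt_eqF// (lt_le_trans _ t1).
rewrite /Rintegral (@continuous_FTC2 _ _ (@ln R))//.
- by rewrite expRK ln1 sube0.
- by apply: continuous_in_subspaceT => t /[!inE]; exact: cV.
- split.
  + move=> t; rewrite in_itv/= => /andP[t1 _].
    have t0 : 0 < t by rewrite (lt_trans _ t1).
    by have /@ex_derive := is_derive1_ln t0.
  + by apply: cvg_at_right_filter; exact: continuous_ln.
  + by apply: cvg_at_left_filter; apply: continuous_ln; exact: expR_gt0.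
- move=> t; rewrite in_itv/= => /andP[t1 _].
  have t0 : 0 < t by rewrite (lt_trans _ t1).
  by rewrite derive1E; have /@derive_val := is_derive1_ln t0.
Qed.

Lemma Rintegral_div_id_close (G1 G2 : R -> R) (d : R) :
  (forall t : R, 0 < t -> {for t, continuous G1}) ->
  (forall t : R, 0 < t -> {for t, continuous G2}) ->
  (forall t : R, 1 <= t <= expR w^-1 -> `|G1 t - G2 t| <= d) ->
  `|\int[mu]_(t in I) (G1 t / t) - \int[mu]_(t in I) (G2 t / t)| <= d * w^-1.
Proof.
move=> c1 c2 G12.
have i1 := integrable_div_id G1 c1; have i2 := integrable_div_id G2 c2.
rewrite -RintegralB//.
have i12 : mu.-integrable I (EFin \o (fun t => G1 t / t - G2 t / t)).
  by have := integrableB _ i1 i2; apply.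
apply: (le_trans (le_normr_Rintegral _ i12)) => //.
have -> : d * w^-1 = \int[mu]_(t in I) (d / t).
  rewrite RintegralZl ?Rintegral_inv//; exact: integrable_inv.
apply: le_Rintegral => //.
- exact: (integrable_norm i12).
- by apply: integrable_div_id => t _; exact: cst_continuous.
move=> t; rewrite /= in_itv/= => t1.
have t0 : 0 < t by case/andP: t1 => t1 _; rewrite (lt_le_trans _ t1).
rewrite -mulrBl normrM (gtr0_norm (x := t^-1)) ?invr_gt0//.
by rewrite ler_pM2r ?invr_gt0// G12.
Qed.

(* Estimating [G1 - G2] only where it is integrated requires the inner iterated
   integrals to be integrable in [t]; the bound at depth [n], applied to
   dilates of [g], is itself what makes them log-uniformly continuous. *)
Lemma iint_close n (g1 g2 : R -> R) (d : R) :
  log_unif_cont R g1 -> log_unif_cont R g2 ->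
  (forall s : R, 1 <= s <= expR (n%:R * w^-1) -> `|g1 s - g2 s| <= d) ->
  `|iint w n g1 - iint w n g2| <= d * w^-1 ^+ n.
Proof.
elim: n g1 g2 d => [|n IH] g1 g2 d u1 u2 g12 /=.
  by rewrite expr0 mulr1 g12// lexx mul0r expR0 lexx.
have ciint g : log_unif_cont R g ->
    forall t : R, 0 < t -> {for t, continuous (fun t : R => iint w n (fun s => g (t * s)))}.
  move=> ug t; apply: log_unif_cont_continuous => e e0.
  (* The $n$ inner integrals multiply a uniform error by $w^{-n}$, so the modulus of [g] is taken at
     $e\,w^n$. *)
  have ew0 : 0 < e * w ^+ n by rewrite mulr_gt0// exprn_gt0.
  have [d0 d00 hd] := ug _ ew0; exists d0 => // x y x0 y0 xy.
  rewrite -[leRHS](@mulfK _ (w ^+ n)) ?gt_eqF ?exprn_gt0// -exprVn.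
  apply: IH; [exact: log_unif_cont_scale..|].
  move=> s /andP[s1 _]; have s0 : 0 < s by rewrite (lt_le_trans _ s1).
  apply: hd; rewrite ?mulr_gt0// !lnM ?posrE//.
  by rewrite opprD addrACA subrr addr0.
rewrite exprS mulrA -mulrAC; apply: Rintegral_div_id_close; [exact: ciint..|].
move=> t /andP[t1 te]; have t0 : 0 < t by rewrite (lt_le_trans _ t1).
apply: IH; [exact: log_unif_cont_scale..|] => s /andP[s1 se].
(* With $t\le e^{1/w}$ and $s\le e^{n/w}$, the product stays in $[1,e^{(n+1)/w}]$. *)
apply: g12; rewrite -[leLHS]mulr1 ler_pM//=.
rewrite -natr1 mulrDl mul1r addrC expRD ler_pM// ltW//.
by rewrite (lt_le_trans _ s1).
Qed.

Lemma iint_cst n (v : R) : iint w n (fun=> v) = v * w^-1 ^+ n.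
Proof.
elim: n => [|n IH] /=; first by rewrite expr0 mulr1.
rewrite IH RintegralZl ?Rintegral_inv ?exprSr ?mulrA//; exact: integrable_inv.
Qed.

End iint.

(** * Binomial combinations and the coefficients of the operator *)

(** Expand $(1-1)^r=0$ and isolate the term $m=0$. Hence [sample] reproduces constants, and a value
    [v] can be subtracted inside its sum. *)
Lemma alt_binom_sum (R : realType) (r : nat) : (0 < r)%N ->
  \sum_(1 <= m < r.+1) ((-1) ^+ (1 + m) * 'C(r, m)%:R) = 1 :> R.
Proof.
move=> r0; have : (1 - 1) ^+ r = 0 :> R by rewrite subrr expr0n gtn_eqF.
rewrite exprDn -(big_mkord xpredT (fun i => (1 ^+ (r - i) * (-1) ^+ i) *+ 'C(r, i))).
rewrite big_nat_recl// big_add1/= expr1n expr0 mulr1 bin0 => h.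
apply: (@addIr _ (\sum_(0 <= i < r) 1 ^+ (r - i.+1) * (-1) ^+ i.+1 *+ 'C(r, i.+1))).
rewrite h -big_split/= big1// => i _.
by rewrite expr1n mul1r mulr_natr add1n (exprS _ i.+1) mulN1r mulNrn addNr.
Qed.

(** Expand $(1+1)^r$ and drop the term $m=0$; this is the source of every factor $2^r$ below. *)
Lemma binom_sum_le (R : realType) (r : nat) :
  \sum_(1 <= m < r.+1) 'C(r, m)%:R <= 2 ^+ r :> R.
Proof.
rewrite -[2]/(1 + 1) exprDn.
rewrite -(big_mkord xpredT (fun i => (1 ^+ (r - i) * 1 ^+ i) *+ 'C(r, i))).
rewrite big_nat_recl// [leLHS]big_add1/= -[leLHS]add0r lerD//.
by apply: ler_sum => i _; rewrite !expr1n mulr1.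
Qed.

Section coefficients.
Variables (R : realType) (r : nat) (f : R -> R) (w : R).
Hypotheses (r0 : (0 < r)%N) (w0 : 0 < w) (uf : log_unif_cont R f).

Definition sample (k : int) (P : R) : R :=
  \sum_(1 <= m < r.+1)
    ((-1) ^+ (1 + m) * 'C(r, m)%:R * f (expR (k%:~R / w) * P `^ (m%:R / r%:R))).

(** This is the $c_k$ of the overview: the factor $w^r$ turns the iterated integral into an
    average. *)
Definition coef (k : int) : R := w ^+ r * iint w r (sample k).

Lemma alt_binom_comb_le (a : nat -> R) (d : R) : 0 <= d ->
  (forall m, (0 < m <= r)%N -> `|a m| <= d) ->
  `|\sum_(1 <= m < r.+1) ((-1) ^+ (1 + m) * 'C(r, m)%:R * a m)| <= 2 ^+ r * d.
Proof.
move=> d0 ad; rewrite (le_trans (ler_norm_sum _ _ _))//.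
rewrite (@le_trans _ _ ((\sum_(1 <= m < r.+1) 'C(r, m)%:R) * d))//; last first.
  by rewrite ler_wpM2r// binom_sum_le.
rewrite mulr_suml big_nat_cond [leRHS]big_nat_cond.
apply: ler_sum => m; rewrite andbT => mr.
by rewrite !normrM normrX normrN1 expr1n mul1r normr_nat ler_wpM2l// ad.
Qed.

Lemma sample_close k (P v d : R) : 0 <= d ->
  (forall m, (0 < m <= r)%N ->
     `|f (expR (k%:~R / w) * P `^ (m%:R / r%:R)) - v| <= d) ->
  `|sample k P - v| <= 2 ^+ r * d.
Proof.
move=> d0 fv; rewrite -[v in leLHS]mul1r -[X in _ - X * _](alt_binom_sum R r r0) mulr_suml /sample -sumrB.
under eq_bigr do rewrite -mulrBr.
exact: alt_binom_comb_le.
Qed.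

(** Since $m/r\le 1$, the map $P\mapsto e^{k/w}P^{m/r}$ does not increase logarithmic distances, so
    the modulus of [f] still serves. *)
Lemma log_unif_cont_sample k : log_unif_cont R (sample k).
Proof.
move=> e e0; have e'0 : 0 < e / 2 ^+ r by rewrite divr_gt0// exprn_gt0.
have [d d0 hd] := uf _ e'0; exists d => // x y x0 y0 xy.
rewrite /sample -sumrB; under eq_bigr do rewrite -mulrBr.
rewrite -[leRHS](@divfK _ (2 ^+ r)) ?expf_neq0// [leRHS]mulrC.
apply: alt_binom_comb_le; first exact: ltW.
move=> m /andP[m0 mr]; apply: hd; rewrite ?mulr_gt0 ?expR_gt0 ?powR_gt0//.
rewrite !lnM ?posrE ?expR_gt0 ?powR_gt0// opprD addrACA subrr add0r !ln_powR.
rewrite -mulrBr normrM (le_lt_trans _ xy)// ler_piMl// ger0_norm ?divr_ge0//.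
by rewrite ler_pdivrMr ?ltr0n// mul1r ler_nat.
Qed.

(** For $1\le s\le e^{r/w}$ the logarithm of the node $e^{k/w}s^{m/r}$ lies in $[k/w,(k+r)/w]$, so
    [coef k] depends on [f] only in that window. Writing [v] as the normalized integral of a
    constant reduces the claim to [iint_close]. *)
Lemma coef_close k (v d : R) : 0 <= d ->
  (forall y : R, 0 < y -> `|ln y - k%:~R / w| <= r%:R / w -> `|f y - v| <= d) ->
  `|coef k - v| <= 2 ^+ r * d.
Proof.
move=> d0 fv.
have wr0 : 0 < w ^+ r by rewrite exprn_gt0.
have -> : v = w ^+ r * iint w r (fun=> v).
  by rewrite iint_cst// exprVn mulrCA divff ?mulr1// gt_eqF.
rewrite -mulrBr normrM gtr0_norm// -ler_pdivlMl// mulrC -exprVn.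
apply: iint_close => //; [exact: log_unif_cont_sample|exact: log_unif_cont_cst|].
move=> s /andP[s1 se]; have s0 : 0 < s by rewrite (lt_le_trans _ s1).
apply: sample_close => // m /andP[m0 mr].
apply: fv; first by rewrite mulr_gt0 ?expR_gt0 ?powR_gt0.
rewrite lnM ?posrE ?expR_gt0 ?powR_gt0// expRK addrAC subrr add0r ln_powR.
have ls0 : 0 <= ln s by rewrite ln_ge0.
rewrite ger0_norm ?mulr_ge0 ?divr_ge0//.
have lse : ln s <= r%:R / w by rewrite -(expRK (_ / _)) ler_ln ?posrE ?expR_gt0.
rewrite (le_trans _ lse)// ler_piMl//.
by rewrite ler_pdivrMr ?ltr0n// mul1r ler_nat.
Qed.

End coefficients.

Lemma E_op_coef (R : realType) (chi : R -> R) (w : R) r (f : R -> R) (x : R) :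
  E_op chi w r f x =
  zsum (fun k => chi (expR (- k%:~R) * x `^ w) * coef R r f w k).
Proof.
by rewrite /E_op; congr zsum; apply/funext => k; rewrite /coef mulrA.
Qed.

(** * Symmetric partial sums over the integers *)

Lemma zpsum_le_esum (R : realType) (a : int -> R) (D : set int) (N : nat) :
  (forall k, 0 <= a k) ->
  ((zpsum (fun k => if k \in D then a k else 0) N)%:E <= \esum_(k in D) (a k)%:E)%E.
Proof.
move=> a0; pose s := [seq i%:Z - N%:Z | i <- index_iota 0 (2 * N).+1].
have us : uniq s.
  by rewrite map_inj_uniq ?iota_uniq// => i j /addIr[].
rewrite esum_mkcond; apply: esum_ge; exists [set` s].
  by split => //; exact: finite_seq.
rewrite -fsbig_seq// big_map /zpsum -sumEFin.
by apply: lee_sum => i _; case: ifP.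
Qed.

(** Passing from $n$ to $n+1$ shifts the summation index by one and adds only the terms at
    $\pm(n+1)$, which vanish once $n\ge N$. *)
Lemma zpsum_eventually (R : realType) (F : int -> R) (N : nat) :
  (forall k : int, N%:R < `|k%:~R| :> R -> F k = 0) ->
  forall n, (N <= n)%N -> zpsum F n = zpsum F N.
Proof.
move=> F0; elim=> [|n IH]; first by rewrite leqn0 => /eqP ->.
rewrite leq_eqVlt => /predU1P[->//|]; rewrite ltnS => Nn.
rewrite -IH// /zpsum mulnS add2n big_nat_recr// big_nat_recl//=.
rewrite (F0 (0 - _)); last first.
  by rewrite sub0r mulrNz normrN normr_nat ltr_nat ltnS.
rewrite (F0 ((2 * n).+2%:Z - _)); last first.
  rewrite (_ : _ - _ = n.+1%:Z) ?normr_nat ?ltr_nat ?ltnS//.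
  by apply/eqP; rewrite subr_eq -PoszD mul2n -addnn addnS addSn.
rewrite add0r addr0; apply: eq_bigr => i _; congr F.
by rewrite -[i.+1]addn1 -[n.+1]addn1 !PoszD; ring.
Qed.

(** * Uniform convergence of the operators *)

Section uniform.
Variables (R : realType) (r : nat) (chi f : R -> R).
Hypotheses (r0 : (0 < r)%N) (kchi : is_kernel chi) (CBf : CB_comp f).

(** Apply [coef_close] with $v=d=0$: as $w\ge 1$, the window around $k/w$ has radius at most $r$ and
    misses the support of [f]. *)
Lemma coef_eq0 (A w : R) (k : int) : 1 <= w ->
  (forall x : R, 0 < x -> A < `|ln x| -> f x = 0) ->
  w * (A + r%:R) < `|k%:~R| -> coef R r f w k = 0.
Proof.
move=> w1 fA Ak; have w0 : 0 < w by rewrite (lt_le_trans _ w1).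
suff : `|coef R r f w k - 0| <= 2 ^+ r * 0.
  by rewrite subr0 mulr0 normr_le0 => /eqP.
apply: coef_close => //; first exact: CB_comp_log_unif_cont.
move=> y y0 yk; rewrite fA ?subrr ?normr0//.
have hk : A + r%:R < `|k%:~R / w|.
  by rewrite normrM normfV (gtr0_norm w0) ltr_pdivlMr// mulrC.
have hr : r%:R / w <= r%:R by rewrite ler_pdivrMr// ler_peMr.
have := lerB_dist (k%:~R / w) (ln y); rewrite distrC => h.
lra.
Qed.

(** The partial sums are eventually constant, so the limit defining [zsum] exists and the operator
    is a finite sum. *)
Lemma E_op_zpsum (w x : R) (N : nat) :
  (forall k : int, N%:R < `|k%:~R| :> R -> coef R r f w k = 0) ->
  E_op chi w r f x =
  zpsum (fun k => chi (expR (- k%:~R) * x `^ w) * coef R r f w k) N.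
Proof.
move=> c0; rewrite E_op_coef /zsum; apply: cvg_lim => //.
apply: cvg_near_cst; exists N => // n /= Nn; apply/eqP.
by rewrite (@zpsum_eventually _ _ N)// => k /c0 ->; rewrite mulr0.
Qed.

Lemma kernel_zpsum_le (u : R) (N : nat) : 0 < u ->
  zpsum (fun k => `|chi (expR (- k%:~R) * u)|) N <= fine (M0 chi).
Proof.
move=> u0; have [_ [_ [_ [_ [Mfin _]]]]] := kchi.
have zM : ((zpsum (fun k => `|chi (expR (- k%:~R) * u)|) N)%:E <= M0 chi)%E.
  apply: (@le_trans _ _ (\esum_(k in [set: int]) `|chi (expR (- k%:~R) * u)|%:E)%E).
    have := zpsum_le_esum R (fun k => `|chi (expR (- k%:~R) * u)|) [set: int] N.
    by move=> /(_ (fun=> normr_ge0 _)); under [X in zpsum X]eq_fun do rewrite in_setT.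
  by apply: ereal_sup_ubound; exists u.
rewrite -lee_fin fineK// fin_numE; apply/andP; split; last by rewrite lt_eqF.
by rewrite gt_eqF// (lt_le_trans _ zM)// ltNyr.
Qed.

Lemma E_op_uniform_cvg (delta : R) : 0 < delta ->
  exists w0 : R, forall w, w0 < w -> forall x, 0 < x ->
    `|E_op chi w r f x - f x| <= delta.
Proof.
move=> delta0.
have [A A0 fA] := CB_comp_log_support R f CBf.
have uf := CB_comp_log_unif_cont R f CBf.
have [_ [[B fB] _]] := CBf.
have [_ [_ [_ [chi1 [_ tail]]]]] := kchi.
have B0 : 0 <= B by rewrite (le_trans _ (fB 1 _)).
set M := fine (M0 chi).
have M0 : 0 <= M.
  apply: le_trans (kernel_zpsum_le 1 0%N ltr01).
  by rewrite /zpsum; apply: sumr_ge0.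
pose D := 2 ^+ r * (2 * B).
have D0 : 0 <= D by rewrite mulr_ge0 ?exprn_ge0 ?mulr_ge0.
have M10 : M + 1 != 0 by rewrite gt_eqF// ltr_wpDl.
have D10 : D + 1 != 0 by rewrite gt_eqF// ltr_wpDl.
have P0 : 2 ^+ r != 0 :> R by rewrite expf_neq0.
(* [e1] bounds the kernel tail, whose terms have weight [D]; [e2] bounds the oscillation of [f],
   weighted by $2^rM$. Each contributes at most [delta / 2], and the [+ 1] avoids division by
   zero. *)
pose e1 := delta / (2 * (D + 1)).
pose e2 := delta / (2 * (M + 1)) / 2 ^+ r.
have e10 : 0 < e1 by rewrite divr_gt0// mulr_gt0// ltr_wpDl.
have e20 : 0 < e2 by rewrite !divr_gt0 ?exprn_gt0// mulr_gt0// ltr_wpDl.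
have b1 : 2 ^+ r * e2 * M <= delta / 2.
  have -> : 2 ^+ r * e2 * M = delta / 2 * (M / (M + 1)).
    by rewrite /e2; field; rewrite ?P0 ?M10.
  apply: ler_piMr; first by rewrite ltW// divr_gt0.
  by rewrite ltW// ltr_pdivrMr ?ltr_wpDl// mul1r ltrDl.
have b2 : D * e1 <= delta / 2.
  have -> : D * e1 = delta / 2 * (D / (D + 1)).
    by rewrite /e1; field; rewrite ?D10.
  apply: ler_piMr; first by rewrite ltW// divr_gt0.
  by rewrite ltW// ltr_pdivrMr ?ltr_wpDl// mul1r ltrDl.
have [g0 /(_ (Num.max g0 0 + 1)) tailg] := tail e1 e10.
set g := Num.max g0 0 + 1 in tailg.
have gg0 : 0 <= g by rewrite addr_ge0// le_max lexx orbT.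
have {tailg}/tailg tailg : g0 < g.
  by rewrite ltr_pwDr// le_max lexx.
have [d d0 fd] := uf e2 e20.
(* The second bound gives $(g+r)/w<d$: when $|k-w\ln x|\le g$, all nodes of [coef k] are within [d]
   of [x] logarithmically. *)
exists (Num.max 1 ((g + r%:R) / d)) => w; rewrite gt_max => /andP[w1 wd] x x0.
have w0 : 0 < w by exact: lt_trans w1.
pose N := (Num.truncn (w * (A + r%:R))).+1.
have c0 k : N%:R < `|k%:~R| :> R -> coef R r f w k = 0.
  move=> Nk; apply: (coef_eq0 A) => //; first exact: ltW.
  by rewrite (lt_trans _ Nk)// truncnS_gt.
have EN n : (N <= n)%N -> E_op chi w r f x =
    zpsum (fun k => chi (expR (- k%:~R) * x `^ w) * coef R r f w k) n.
  move=> Nn; apply: E_op_zpsum => k nk; apply: c0; rewrite (le_lt_trans _ nk)//.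
  by rewrite ler_nat.
have xw0 : 0 < x `^ w by exact: powR_gt0.
pose c k := chi (expR (- k%:~R) * x `^ w).
pose T := [set k : int | g < `|k%:~R - ln (x `^ w)|].
(* Far indices get the crude bound $2B$ on differences of values of [f], near ones its uniform
   continuity. *)
have ck k : `|coef R r f w k - f x| <= 2 ^+ r * e2 + (if k \in T then D else 0).
  case: ifPn => [_|].
    rewrite -[leLHS]add0r lerD//; first by rewrite mulr_ge0 ?exprn_ge0 ?ltW.
    apply: coef_close => //; first by rewrite mulr_ge0.
    move=> y y0 _; rewrite (le_trans (ler_normB _ _))// mulr2n mulrDl mul1r.
    by rewrite lerD ?fB.
  rewrite notin_setE /T/= => /negP; rewrite -leNgt ln_powR => kx.
  rewrite addr0; apply: coef_close => //; first exact: ltW.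
  move=> y y0 yk; apply: fd => //.
  have h1 : `|k%:~R / w - ln x| <= g / w.
    rewrite ler_pdivlMr// -[X in _ * X](gtr0_norm w0) -normrM mulrBl.
    by rewrite divfK ?gt_eqF// [ln x * w]mulrC.
  have h2 : g / w + r%:R / w < d.
    by rewrite -mulrDl ltr_pdivrMr// mulrC -ltr_pdivrMr.
  rewrite -(subrKA (k%:~R / w)) (le_lt_trans (ler_normD _ _))//.
  by rewrite (le_lt_trans _ h2)// addrC lerD.
(* The kernel sums to 1 only in the limit, so [f x] is first multiplied by a partial sum; afterwards
   $n\to\infty$. *)
have bound n : (N <= n)%N -> `|E_op chi w r f x - f x * zpsum c n| <= delta.
  move=> Nn; rewrite (EN n Nn) /zpsum mulr_sumr -sumrB.
  rewrite (le_trans (ler_norm_sum _ _ _))//.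
  apply: (@le_trans _ _ (2 ^+ r * e2 * zpsum (fun k => `|c k|) n +
      D * zpsum (fun k => if k \in T then `|c k| else 0) n)).
    rewrite /zpsum !mulr_sumr -big_split/=; apply: ler_sum => i _.
    set k := (i%:Z - n%:Z).
    rewrite -/(c k) [f x * _]mulrC -mulrBr normrM.
    rewrite (le_trans (ler_wpM2l (normr_ge0 _) (ck k)))//.
    by rewrite mulrDr lerD// 1?mulrC//; case: ifP => _; rewrite ?mulr0// mulrC.
  have t1 : zpsum (fun k => if k \in T then `|c k| else 0) n <= e1.
    rewrite -lee_fin (le_trans _ (tailg _ xw0))//.
    by have := zpsum_le_esum R (fun k => `|c k|) T n (fun=> normr_ge0 _).
  have t2 := kernel_zpsum_le (x `^ w) n xw0.
  have -> : delta = delta / 2 + delta / 2 by rewrite -splitr.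
  apply: lerD.
    by rewrite (le_trans _ b1)// ler_wpM2l// mulr_ge0 ?exprn_ge0 ?ltW.
  by rewrite (le_trans _ b2)// ler_wpM2l.
have cvgE : `|E_op chi w r f x - f x * zpsum c n| @[n --> \oo]
    --> `|E_op chi w r f x - f x|.
  apply: cvg_norm; apply: cvgB; first exact: cvg_cst.
  rewrite -[X in _ --> X]mulr1; apply: cvgM; first exact: cvg_cst.
  exact: chi1.
rewrite -(cvg_lim _ cvgE)//; apply: limr_le; first by apply/cvg_ex; eexists; exact: cvgE.
by exists N => // n /= Nn; exact: bound.
Qed.

End uniform.

(* No measurability is needed: the integral of a nonnegative function is a
   supremum over the simple functions below it. *)
Lemma le_integral_nonmeasurable d (T : measurableType d) (R : realType)
    (mu : {measure set T -> \bar R}) (D : set T) (f g : T -> \bar R) :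
  (forall x, D x -> (0 <= f x)%E) -> (forall x, D x -> (f x <= g x)%E) ->
  (\int[mu]_(x in D) f x <= \int[mu]_(x in D) g x)%E.
Proof.
move=> f0 fg; rewrite !ge0_integralE//; last first.
  by move=> x Dx; rewrite (le_trans (f0 _ Dx))// fg.
apply: ereal_sup_le => _ [h hf <-]; exists h => // x /=.
by rewrite (le_trans (hf x))//; exact: lee_restrict.
Qed.

(** * Integration for $dx/x$ on the positive half-line *)

Section positive_half_line.
Context (R : realType).
Local Notation mu := (@lebesgue_measure R).

Lemma open_Rpos : open (@Rpos R).
Proof. exact: (@open_gt R 0). Qed.

Lemma measurable_Rpos : measurable (@Rpos R : set (measurableTypeR R)).
Proof. exact: (open_measurable open_Rpos). Qed.

Lemma measurable_fun_Rpos (g : R -> R) :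
  (forall x : R, 0 < x -> {for x, continuous g}) ->
  measurable_fun (@Rpos R) (fun x : R => (g x)%:E).
Proof.
move=> cg; apply/measurable_EFinP; apply: open_continuous_measurable_fun; first exact: open_Rpos.
by move=> x /[!inE]; exact: cg.
Qed.

Lemma continuous_div_id (g : R -> R) (x : R) : 0 < x ->
  {for x, continuous g} -> {for x, continuous (fun t => g t / t)}.
Proof.
move=> x0 cg; apply: (@continuousM _ _ g (fun t => t^-1)) => //.
by apply: continuousV => //; rewrite gt_eqF.
Qed.

Lemma is_derive_scaled_powR (c w x : R) : 0 < x ->
  is_derive x 1 (fun t => c * t `^ w) (c * (w * x `^ (w - 1))).
Proof.
by move=> x0; have := is_derive1_powR w x0 => ?; exact: is_deriveZ.
Qed.

Lemma continuous_scaled_powR (c w x : R) : 0 < x ->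
  {for x, continuous (fun t => c * t `^ w)}.
Proof.
move=> x0; apply/differentiable_continuous/derivable1_diffP.
by have /@ex_derive := is_derive_scaled_powR c w x x0.
Qed.

(** The substitution $y=cx^w$ gives $dx/x=dy/(wy)$. It is made on the compact intervals
    $[1/(i+1),i+1]$, whose images lie in the half-line, and monotone convergence exhausts the
    domain. *)
Lemma integral_scaled_powR_le (h : R -> R) (c w : R) : 0 < c -> 0 < w ->
  (forall y : R, 0 < y -> {for y, continuous h}) ->
  (forall y : R, 0 < y -> 0 <= h y) ->
  (\int[mu]_(x in @Rpos R) (h (c * x `^ w) / x)%:E <=
   w^-1%:E * \int[mu]_(y in @Rpos R) (h y / y)%:E)%E.
Proof.
move=> c0 w0 ch h0.
pose F (x : R) := c * x `^ w.
have F0 (x : R) : 0 < x -> 0 < F x by move=> x0; rewrite mulr_gt0// powR_gt0.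
have cF (x : R) : 0 < x -> {for x, continuous F} by exact: continuous_scaled_powR.
have dF (x : R) : 0 < x -> (derive1 F) x = c * (w * x `^ (w - 1)).
  move=> x0; rewrite derive1E.
  by have /@derive_val := is_derive_scaled_powR c w x x0.
have cdF (x : R) : 0 < x -> {for x, continuous (derive1 F)}.
  move=> x0.
  have : {for x, continuous (fun t => (c * w) * t `^ (w - 1))}.
    exact: continuous_scaled_powR.
  (* The formula for the derivative is available only at positive points, but these fill a
     neighbourhood of [x]. *)
  rewrite /prop_for /continuous_at dF// mulrA; apply: cvg_trans.
  apply: near_eq_cvg; have : \forall y \near x, 0 < y by exact: lt_nbhsr.
  by apply: filterS => y y0; rewrite dF// mulrA.
have cG (y : R) : 0 < y -> {for y, continuous (fun t => h t / t)}.
  by move=> y0; apply: continuous_div_id => //; exact: ch.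
have chF (x : R) : 0 < x -> {for x, continuous (fun x => h (F x) / x)}.
  move=> x0; apply: continuous_div_id => //.
  by apply: (@continuous_comp _ _ _ F h); [exact: cF|apply/ch/F0].
pose K (i : nat) := `[i.+1%:R^-1, i.+1%:R : R]%classic.
have K0 i x : K i x -> 0 < x.
  by rewrite /K/= in_itv/= => /andP[+ _]; apply: lt_le_trans; rewrite invr_gt0.
have UK : \bigcup_i K i = @Rpos R.
  apply/seteqP; split => [x [i _ /K0]//|x x0]; rewrite /Rpos/= in x0.
  exists (maxn (Num.truncn x) (Num.truncn x^-1)) => //; rewrite /K/= in_itv/=.
  rewrite -[x in _^-1 <= x]invrK lef_pV2 ?posrE ?invr_gt0//; apply/andP; split.
    by rewrite (le_trans (ltW (truncnS_gt _)))// ler_nat ltnS leq_maxr.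
  by rewrite (le_trans (ltW (truncnS_gt _)))// ler_nat ltnS leq_maxl.
have mG : measurable_fun (@Rpos R) (fun y : R => (h y / y)%:E).
  exact: (measurable_fun_Rpos (fun y => h y / y)).
have mhF : measurable_fun (@Rpos R) (fun x : R => (h (F x) / x)%:E).
  exact: (measurable_fun_Rpos (fun x => h (F x) / x)).
have bound i : (\int[mu]_(x in K i) (h (F x) / x)%:E <=
    w^-1%:E * \int[mu]_(y in @Rpos R) (h y / y)%:E)%E.
  set a : R := i.+1%:R^-1; set b : R := i.+1%:R.
  have a0 : 0 < a by rewrite invr_gt0.
  have ab : a <= b.
    by rewrite (@le_trans _ _ 1)// ?ler1n// invf_le1// ler1n.
  have KR : K i `<=` @Rpos R by move=> x /K0.
  have FR : `[F a, F b] `<=` @Rpos R.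
    move=> y; rewrite /= in_itv/= => /andP[+ _]; apply: lt_le_trans; exact: F0.
  have mK : measurable_fun (K i) (fun x : R => (h (F x) / x)%:E).
    by apply: (measurable_funS measurable_Rpos).
  have -> : (\int[mu]_(x in K i) (h (F x) / x)%:E =
             w^-1%:E * \int[mu]_(y in `[F a, F b]) (h y / y)%:E)%E.
    rewrite (@integration_by_substitution_increasing _ F (fun y => h y / y) a b)//.
    - rewrite [X in (_ * X)%E](@eq_integral _ _ _ mu _ (fun x => (w%:E * (h (F x) / x)%:E)%E)); last first.
        move=> x /[!inE] /K0 x0; rewrite -EFinM !fctE/= dF//; congr (_%:E).
        rewrite /F; have -> : x `^ w = x `^ (w - 1) * x.
          rewrite -[X in _ `^ X = _](subrK 1 w) (@powRD _ x (w - 1) 1) ?powRr1 ?(ltW x0)//.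
          by rewrite (gt_eqF x0) implybT.
        by field; rewrite ?(gt_eqF x0) ?(gt_eqF c0) ?gt_eqF ?powR_gt0.
      rewrite ge0_integralZl_EFin ?(ltW w0)//; last first.
        by move=> x /K0 x0; rewrite lee_fin divr_ge0 ?h0 ?F0 ?(ltW x0).
      by rewrite muleA -EFinM mulVf ?mul1e// gt_eqF.
    - move=> x y; rewrite !in_itv/= => /andP[ax _] /andP[ay _] xy.
      by rewrite /F ltr_pM2l// gt0_ltr_powR// nnegrE (le_trans (ltW a0)).
    - by move=> x; rewrite in_itv/= => /andP[ax _]; apply: cdF; exact: lt_trans ax.
    - by apply/cvg_ex; eexists; apply: cvg_at_right_filter; exact: cdF.
    - apply/cvg_ex; eexists; apply: cvg_at_left_filter; apply: cdF.
      exact: lt_le_trans ab.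
    - split.
      + move=> x; rewrite in_itv/= => /andP[ax _].
        by have /@ex_derive := is_derive_scaled_powR c w x (lt_trans a0 ax).
      + by apply: cvg_at_right_filter; exact: cF.
      + by apply: cvg_at_left_filter; apply: cF; exact: lt_le_trans ab.
    - apply: continuous_in_subspaceT => y /[!inE] /FR; exact: cG.
  rewrite lee_pmul2l//; last by rewrite lte_fin invr_gt0.
  apply: ge0_subset_integral => //; first exact: measurable_Rpos.
  by move=> y y0; rewrite lee_fin divr_ge0 ?h0// ltW.
rewrite -UK.
have cvgK : (\int[mu]_(x in K i) (h (F x) / x)%:E)%E @[i --> \oo] -->
    (\int[mu]_(x in \bigcup_i K i) (h (F x) / x)%:E)%E.
  apply: ge0_nondecreasing_set_cvg_integral => //.
  - move=> n m nm; apply/subsetPset => x; rewrite /K/= !in_itv/= => /andP[nx xn].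
    rewrite (le_trans _ nx) ?lef_pV2 ?posrE// ?ler_nat ?ltnS//=.
    by rewrite (le_trans xn)// ler_nat ltnS.
  - by move=> i; exact: measurable_itv.
  - move=> i; have KR : K i `<=` @Rpos R by move=> x /K0.
    exact: (measurable_funS measurable_Rpos KR mhF).
  - by move=> i x /K0 x0; rewrite lee_fin divr_ge0 ?h0 ?F0// ltW.
rewrite -(cvg_lim _ cvgK)//; apply: lime_le.
  by apply/cvg_ex; eexists; exact: cvgK.
by apply: nearW => i; rewrite UK.
Qed.

(** A continuous majorant of the indicator of $|\ln y|\ge n+1$ that tends to 0 pointwise; [n.+1]
    keeps the denominator positive. *)
Definition log_cutoff (n : nat) (y : R) : R := Num.min 1 (`|ln y| / n.+1%:R).

Lemma log_cutoff_ge0 n y : 0 <= log_cutoff n y.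
Proof. by rewrite le_min ler01 divr_ge0. Qed.

Lemma log_cutoff_le1 n y : log_cutoff n y <= 1.
Proof. by rewrite ge_min lexx. Qed.

Lemma log_cutoff_eq1 n y : n.+1%:R <= `|ln y| -> log_cutoff n y = 1.
Proof. by move=> ny; apply/min_idPl; rewrite ler_pdivlMr// mul1r. Qed.

Lemma continuous_log_cutoff n (y : R) : 0 < y -> {for y, continuous (log_cutoff n)}.
Proof.
move=> y0; apply: (@continuous_min _ _ (fun=> 1) (fun t => `|ln t| / n.+1%:R)).
  exact: cst_continuous.
apply: (@continuousM _ _ (fun t : R => `|ln t|) (fun=> n.+1%:R^-1)); last exact: cst_continuous.
by apply: (@continuous_comp _ _ _ (@ln R) Num.norm); [exact: continuous_ln|exact: norm_continuous].
Qed.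

(** Dominated convergence, with $|\chi(x)|/x$ as the dominating function; at each point the
    integrand is at most a constant over $n+1$. *)
Lemma integral_log_cutoff_cvg0 (chi : R -> R) :
  (forall x : R, 0 < x -> {for x, continuous chi}) ->
  (\int[mu]_(x in @Rpos R) (`|chi x| / x)%:E < +oo)%E ->
  (\int[mu]_(x in @Rpos R) (`|chi x| * log_cutoff n x / x)%:E)%E @[n --> \oo] --> 0%E.
Proof.
move=> cchi ichi.
have cn (x : R) : 0 < x -> {for x, continuous (fun t => `|chi t|)}.
  by move=> x0; apply: (@continuous_comp _ _ _ chi Num.norm);
     [exact: cchi|exact: norm_continuous].
have mchi : measurable_fun (@Rpos R) (fun x : R => (`|chi x| / x)%:E).
  apply: (measurable_fun_Rpos (fun x => `|chi x| / x)) => x x0.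
  by apply: continuous_div_id => //; exact: cn.
rewrite -(integral0 mu (@Rpos R)).
apply: (@dominated_cvg _ _ _ mu (@Rpos R) measurable_Rpos _ (cst 0%E)
   (EFin \o (fun x => `|chi x| / x))) => //.
- move=> n; apply: (measurable_fun_Rpos (fun x => `|chi x| * log_cutoff n x / x)) => x x0.
  apply: continuous_div_id => //.
  apply: (@continuousM _ _ (fun t => `|chi t|)); first exact: cn.
  exact: continuous_log_cutoff.
- move=> x x0; apply: cvg_EFin; first exact: nearW.
  apply: (@squeeze_cvgr _ _ _ _ (fun=> 0) (fun n => `|chi x| * `|ln x| / x * n.+1%:R^-1)).
  + apply: nearW => n /=; rewrite /comp/= divr_ge0 ?mulr_ge0 ?log_cutoff_ge0 ?(ltW x0)//=.
    rewrite mulrAC -[leRHS]mulrA [leRHS](_ : _ = `|chi x| / x * (`|ln x| / n.+1%:R)).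
      by rewrite ler_wpM2l// ?divr_ge0 ?(ltW x0)// ge_min lexx orbT.
    by rewrite !mulrA; congr (_ / _); rewrite mulrAC.
  + exact: cvg_cst.
  + rewrite -(mulr0 (`|chi x| * `|ln x| / x)); apply: cvgM; first exact: cvg_cst.
    exact: cvg_harmonic.
- apply/integrableP; split => //.
  under eq_integral => x /[!inE] x0.
    rewrite /= ger0_norm ?divr_ge0 ?(ltW x0)//.
    over.
  exact: ichi.
- move=> n x x0; rewrite /= lee_fin ger0_norm ?divr_ge0 ?mulr_ge0 ?log_cutoff_ge0 ?(ltW x0)//.
  by rewrite ler_wpM2r ?invr_ge0 ?(ltW x0)// ler_piMr// log_cutoff_le1.
Qed.

End positive_half_line.

(** * Convergence of the integral of the $p$-th power *)

Section convergence.
Variables (R : realType) (r : nat) (chi f : R -> R).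
Hypotheses (r0 : (0 < r)%N) (kchi : is_kernel chi) (CBf : CB_comp f).
Local Notation mu := (@lebesgue_measure R).

Lemma powR_le_id (a p : R) : 0 <= a <= 1 -> 1 <= p -> a `^ p <= a.
Proof.
move=> /andP[]; rewrite le_eqVlt => /predU1P[<- _ p1|a0 a1 p1].
  by rewrite powR0// gt_eqF// (lt_le_trans _ p1).
by rewrite -[leRHS]powRr1 ?(ltW a0)// ger_powR// a0.
Qed.

Lemma integral_E_op_le (p e : R) : 1 <= p -> 0 < e ->
  exists w1 : R, forall w, w1 < w ->
  (\int[mu]_(x in @Rpos R) (`|E_op chi w r f x - f x| `^ p / x)%:E <= e%:E)%E.
Proof.
move=> p1 e0.
have [A A0 fA] := CB_comp_log_support R f CBf.
have [_ [[B fB] _]] := CBf.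
have [cchi [ichi _]] := kchi.
have B0 : 0 <= B by rewrite (le_trans _ (fB 1 _)).
(* Off $|\ln x|\le S$ a contributing index has $|k|\le w(A+r)+1$, so $|w\ln x-k|>2w-1\ge w$. The
   margin 2 absorbs the rounding in [N]. *)
pose S := A + r%:R + 2.
(* One factor bounds $1/x$ on [K], the other the Lebesgue measure of [K]. *)
pose c1 := expR S * expR S.
have c10 : 0 < c1 by rewrite mulr_gt0 ?expR_gt0.
pose delta := Num.min 1 (e / 2 / c1).
have delta0 : 0 < delta by rewrite lt_min ltr01 !divr_gt0.
have delta1 : delta <= 1 by rewrite ge_min lexx.
have [w0 unif] := E_op_uniform_cvg R r chi f r0 kchi CBf delta delta0.
pose C := 2 ^+ r * B.
have C0 : 0 <= C by rewrite mulr_ge0// exprn_ge0.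
(* Chosen so that the number $2N+1$ of indices is at most [c2 * w] when $w\ge 1$. *)
pose c2 := 2 * (A + r%:R) + 3.
have c20 : 0 < c2 by rewrite ltr_wpDl// mulr_ge0// addr_ge0// ltW.
pose j := e / 2 / (C * c2 + 1).
have j0 : 0 < j by rewrite !divr_gt0// ltr_wpDl// mulr_ge0// ltW.
pose J n := (\int[mu]_(x in @Rpos R) (`|chi x| * log_cutoff R n x / x)%:E)%E.
have [n Jn] : exists n, (J n <= j%:E)%E.
  have /fine_cvgP[Jfin /cvgrPdist_le /(_ _ j0) Jle] :=
    integral_log_cutoff_cvg0 R chi cchi ichi.
  have [n [Jnfin Jnle]] := filter_ex (filterI Jfin Jle).
  have Jnfin' : J n \is a fin_num by [].
  exists n; rewrite -(fineK Jnfin') lee_fin; apply: le_trans Jnle.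
  by rewrite /= sub0r normrN ler_norm.
(* With $w>n+1$, the inequality $|\ln y|\ge w$ puts $y=e^{-k}x^w$ where the cutoff equals 1. *)
exists (Num.max w0 n.+1%:R) => w; rewrite gt_max => /andP[w0w nw].
have w1 : 1 <= w by rewrite (le_trans _ (ltW nw))// ler1n.
have wp : 0 < w by exact: lt_le_trans w1.
pose N := (Num.truncn (w * (A + r%:R))).+1.
have Ar0 : 0 <= w * (A + r%:R) by rewrite mulr_ge0 ?(ltW wp)// addr_ge0 ?(ltW A0).
have NA : N%:R <= w * (A + r%:R) + 1 by rewrite -natr1 lerD2r truncn_le.
have EN x : E_op chi w r f x =
    zpsum (fun k => chi (expR (- k%:~R) * x `^ w) * coef R r f w k) N.
  apply: E_op_zpsum => k nk; apply: (coef_eq0 R r f r0 CBf A) => //.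
  by rewrite (lt_trans _ nk)// truncnS_gt.
have coefC k : `|coef R r f w k| <= C.
  rewrite -[coef _ _ _ _ _]subr0; apply: coef_close => //.
    exact: CB_comp_log_unif_cont.
  by move=> y y0 _; rewrite subr0 fB.
pose K := `[expR (- S), expR S : R]%classic.
pose z (i : nat) : int := i%:Z - N%:Z.
pose h2 i (x : R) := `|chi (expR (- (z i)%:~R) * x `^ w)| *
  log_cutoff R n (expR (- (z i)%:~R) * x `^ w) / x.
have h20 i x : 0 < x -> 0 <= h2 i x.
  by move=> x0; rewrite divr_ge0 ?mulr_ge0 ?log_cutoff_ge0 ?(ltW x0).
have cutoff_cont y : 0 < y -> {for y, continuous (fun t => `|chi t| * log_cutoff R n t)}.
  move=> y0; apply: (@continuousM _ _ (fun t => `|chi t|)).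
    by apply: (@continuous_comp _ _ _ chi Num.norm); [exact: cchi|exact: norm_continuous].
  exact: continuous_log_cutoff.
have mh2 i : measurable_fun (@Rpos R) (fun x : R => (h2 i x)%:E).
  apply: (measurable_fun_Rpos R (h2 i)) => x x0; apply: continuous_div_id => //.
  apply: (@continuous_comp _ _ _ (fun x => expR (- (z i)%:~R) * x `^ w)
     (fun t => `|chi t| * log_cutoff R n t)); first exact: continuous_scaled_powR.
  by apply: cutoff_cont; rewrite mulr_gt0 ?expR_gt0 ?powR_gt0.
have ih2 i : (\int[mu]_(x in @Rpos R) (h2 i x)%:E <= (w^-1 * j)%:E)%E.
  rewrite EFinM (le_trans _ (lee_wpmul2l _ Jn)) ?lee_fin ?invr_ge0 ?(ltW wp)//.
  apply: (integral_scaled_powR_le R (fun t => `|chi t| * log_cutoff R n t)) => //.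
  by move=> y y0; rewrite mulr_ge0 ?log_cutoff_ge0.
pose h1 (x : R) := delta * expR S * \1_K x.
have dS : 0 <= delta * expR S by rewrite mulr_ge0 ?expR_ge0 ?(ltW delta0).
(* The term [h1] covers [K] by the uniform estimate; off [K], [f x] vanishes and each kernel value
   may be multiplied by a cutoff equal to 1. *)
have bound x : 0 < x -> `|E_op chi w r f x - f x| `^ p / x <=
    h1 x + C * \sum_(0 <= i < (2 * N).+1) h2 i x.
  move=> x0; have Ed := unif w w0w x x0.
  have s0 : 0 <= C * \sum_(0 <= i < (2 * N).+1) h2 i x.
    by rewrite mulr_ge0// sumr_ge0// => i _; exact: h20.
  rewrite (@le_trans _ _ (`|E_op chi w r f x - f x| / x))//.
    by rewrite ler_wpM2r ?invr_ge0 ?(ltW x0)// powR_le_id// normr_ge0/= (le_trans Ed).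
  have [xK|xK] := pselect (K x).
    rewrite -[leLHS]addr0 lerD// /h1 indicE mem_set// mulr1.
    rewrite ler_pM ?invr_ge0 ?(ltW x0)//.
    move: xK; rewrite /K/= in_itv/= => /andP[Sx _].
    by rewrite -[expR S]invrK -expRN lef_pV2 ?posrE ?expR_gt0.
  have Sx : S < `|ln x|.
    rewrite ltNge; apply: contra_notN xK => xS; rewrite /K/= in_itv/=.
    by move: xS; rewrite ler_norml -{3 4}(lnK x0) !ler_expR.
  rewrite /h1 indicE memNset// mulr0 add0r.
  rewrite (fA x x0); last by rewrite (lt_trans _ Sx)// /S -addrA ltrDl ltr_wpDl.
  rewrite subr0 EN /zpsum mulr_sumr.
  apply: (@le_trans _ _ ((\sum_(0 <= i < (2 * N).+1)
     C * `|chi (expR (- (z i)%:~R) * x `^ w)|) / x)).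
    rewrite ler_wpM2r ?invr_ge0 ?(ltW x0)// (le_trans (ler_norm_sum _ _ _))//.
    by apply: ler_sum => i _; rewrite normrM mulrC ler_wpM2r.
  rewrite mulr_suml big_nat_cond [leRHS]big_nat_cond; apply: ler_sum => i.
  rewrite andbT ltnS => /andP[_ iN]; rewrite /h2 log_cutoff_eq1 ?mulr1 ?mulrA//.
  rewrite lnM ?posrE ?expR_gt0 ?powR_gt0// expRK ln_powR.
  have zN : `|(z i)%:~R : R| <= N%:R.
    have iN' : i%:R <= 2 * N%:R :> R by rewrite -natrM ler_nat.
    have i0 : 0 <= i%:R :> R by [].
    rewrite /z intrB -!pmulrn ler_norml; apply/andP; split; lra.
  have h3 : w * S < `|w * ln x| by rewrite normrM (gtr0_norm wp) ltr_pM2l.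
  have h4 := lerB_dist (w * ln x) (z i)%:~R.
  have h5 : w * S = w * (A + r%:R) + w * 2 by rewrite /S mulrDr.
  rewrite addrC; lra.
have mK : measurable (K : set (measurableTypeR R)) by exact: measurable_itv.
have m1 : measurable_fun (@Rpos R) (\1_K : R -> R) by exact: measurable_indic.
have m1K : measurable_fun (@Rpos R) (EFin \o (\1_K : R -> R)).
  exact/measurable_EFinP.
have mh1 : measurable_fun (@Rpos R) (fun x : R => (h1 x)%:E).
  by apply/measurable_EFinP; apply: measurable_funM.
have msum : measurable_fun (@Rpos R)
    (fun x : R => (\sum_(0 <= i < (2 * N).+1) (h2 i x)%:E)%E).
  by apply: emeasurable_sum => i; exact: mh2.
have sum0 x : @Rpos R x -> (0 <= \sum_(0 <= i < (2 * N).+1) (h2 i x)%:E)%E.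
  by move=> x0; apply: sume_ge0 => i _; rewrite lee_fin h20.
apply: (@le_trans _ _ (\int[mu]_(x in @Rpos R)
   ((h1 x)%:E + C%:E * \sum_(0 <= i < (2 * N).+1) (h2 i x)%:E))%E).
  apply: le_integral_nonmeasurable => x x0.
    by rewrite lee_fin divr_ge0 ?powR_ge0// ltW.
  by rewrite sumEFin -EFinM -EFinD lee_fin bound.
rewrite ge0_integralD//; first last.
- exact: measurable_funeM.
- by move=> x /sum0 ?; rewrite mule_ge0.
- by move=> x x0; rewrite lee_fin mulr_ge0.
- exact: measurable_Rpos.
have -> : e%:E = ((e / 2)%:E + (e / 2)%:E)%E by rewrite -EFinD -splitr.
rewrite leeD//.
  rewrite (_ : (fun x => (h1 x)%:E) = (fun x => (delta * expR S)%:E * (\1_K x)%:E)%E)//.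
  rewrite ge0_integralZl_EFin//; last exact: measurable_Rpos.
  rewrite integral_indic//; last exact: measurable_Rpos.
  have muK : (mu (K `&` @Rpos R) <= (expR S)%:E)%E.
    apply: (@le_trans _ _ (mu K)).
      apply: le_measure; rewrite ?inE//.
      exact: (measurableI _ _ mK (measurable_Rpos R)).
    rewrite /K lebesgue_measure_itv/=; case: ifP => _.
      by rewrite -EFinB lee_fin gerBl expR_ge0.
    by rewrite lee_fin expR_ge0.
  rewrite (le_trans (lee_wpmul2l _ muK))// -EFinM lee_fin -mulrA -/c1.
  by rewrite -ler_pdivlMr// ge_min lexx orbT.
rewrite ge0_integralZl_EFin//; last exact: measurable_Rpos.
rewrite ge0_integral_sum//; last exact: measurable_Rpos.
(* The factor $1/w$ from the substitution cancels the $O(w)$ number of indices, leaving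
   $C\,c_2\,j\le e/2$. *)
apply: (@le_trans _ _ (C%:E * \sum_(0 <= i < (2 * N).+1) (w^-1 * j)%:E)%E).
  by rewrite lee_wpmul2l ?lee_fin// lee_sum.
rewrite sumEFin -EFinM lee_fin big_const_nat iter_addr_0 subn0.
have Nw : (2 * N).+1%:R <= c2 * w.
  rewrite -natr1 natrM; have : c2 * w = 2 * (w * (A + r%:R)) + 3 * w by rewrite /c2; ring.
  move=> ->; lra.
rewrite -[X in C * X]mulr_natl; apply: (@le_trans _ _ (C * c2 * j)).
  rewrite [leLHS](_ : _ = C * j * ((2 * N).+1%:R / w)); last by ring.
  rewrite [leRHS]mulrAC (ler_wpM2l (mulr_ge0 C0 (ltW j0)))//.
  by rewrite ler_pdivrMr.
have -> : C * c2 * j = e / 2 * (C * c2 / (C * c2 + 1)) by rewrite /j; ring.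
have Cc0 : 0 <= C * c2 by rewrite mulr_ge0// ltW.
rewrite ler_piMr ?divr_ge0 ?(ltW e0)//.
by rewrite ler_pdivrMr ?mul1r ?lerDl// ltr_wpDl.
Qed.

End convergence.

(** * From the integral to the norm *)

Theorem theorem3 (R : realType) (r : nat) (chi : R -> R) (f : R -> R) (p : R) :
  (0 < r)%N -> is_kernel chi -> (0 < M0 chi)%E -> CB_comp f -> 1 <= p ->
  (fun w : R => Lpnorm p (fun x => E_op chi w r f x - f x)) @ +oo --> 0%E.
Proof.
move=> r0 kchi _ CBf p1.
have p0 : 0 < p by exact: lt_le_trans p1.
set L := fun w : R => Lpnorm p (fun x => E_op chi w r f x - f x).
have small (e : R) : 0 < e -> \forall w \near +oo, (L w <= e%:E)%E.
  move=> e0; have ep0 : 0 < e `^ p by exact: powR_gt0.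
  (* The tolerance $e^p$ becomes [e] after taking the $p$-th root. *)
  have [w1 hw] := integral_E_op_le R r chi f r0 kchi CBf p (e `^ p) p1 ep0.
  have := @nbhs_pinfty_gt _ w1 (num_real _); apply: filterS => w /hw Ile.
  rewrite /L /Lpnorm (_ : e%:E = poweR (e `^ p)%:E p^-1); last first.
    by rewrite poweR_EFin -powRrM divff ?gt_eqF// powRr1// ltW.
  apply: gt0_ler_poweR => //; first by rewrite invr_ge0 ltW.
    rewrite in_itv/= leey andbT; apply: integral_ge0 => x x0.
    by rewrite lee_fin divr_ge0 ?powR_ge0// ltW.
  by rewrite in_itv/= leey andbT lee_fin powR_ge0.
have ge0 w : (0 <= L w)%E by exact: poweR_ge0.
apply/fine_cvgP; split.
  apply: filterS (small 1 ltr01) => w Lw.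
  by rewrite ge0_fin_numE// (le_lt_trans Lw)// ltry.
apply/cvgrPdist_le => e e0; apply: filterS (small e e0) => w Lw.
rewrite /= sub0r normrN ger0_norm ?fine_ge0// -lee_fin fineK//.
by rewrite ge0_fin_numE// (le_lt_trans Lw)// ltry.
Qed.
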